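(* For any $q,r\in(0,1)$ with $q\neq r$, one has $$1\leqslant\|B_q-B_r\|\leqslant 2.$$ The inequalities are sharp in the sense that both equalities are attained: there exist $q\neq r$ in $(0,1)$ with $\|B_q-B_r\|=1$, and there exist $q\neq r$ in $(0,1)$ with $\|B_q-B_r\|=2$.
   Context: For $q\in(0,1)$ and $a\in\mathbb{C}$, write $(a;q)_0:=1$, $(a;q)_k:=\prod_{s=0}^{k-1}(1-aq^s)$ for $k\geqslant 1$, and $(a;q)_\infty:=\prod_{s=0}^{\infty}(1-aq^s)$. For $q\in(0,1)$, $k\in\mathbb{N}_0=\{0,1,2,\dots\}$, $x\in[0,1]$ put $$p_k(q;x):=\frac{x^k\,(x;q)_\infty}{(q;q)_k}$$ (with $x^0=1$). For $q\in(0,1)$ the limit $q$-Bernstein operator $B_q:C[0,1]\to C[0,1]$, $f\mapsto B_qf$, is the bounded linear operator given by $$B_q(f;x)=\sum_{k=0}^{\infty}f(1-q^k)\,p_k(q;x)\ \text{ for } x\in[0,1),\qquad B_q(f;1)=f(1).$$ Here $C[0,1]$ is the space of continuous functions on $[0,1]$ with the supremum norm, and $\|\cdot\|$ applied to operators is the operator norm on $C[0,1]$. *)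

(* Defs.v *)
From mathcomp Require Import all_boot all_order all_algebra.
From mathcomp Require Import all_classical all_reals all_analysis.
Set Implicit Arguments.
Unset Strict Implicit.
Unset Printing Implicit Defensive.
Import Order.TTheory GRing.Theory Num.Theory numFieldNormedType.Exports.

Local Open Scope classical_set_scope.
Local Open Scope ring_scope.

(* The carrier K is arbitrary so that a may also be complex. *)
Definition qpoch (K : numFieldType) (a q : K) (k : nat) : K :=
  \prod_(s < k) (1 - a * q ^+ s).

Definition qpoch_inf (K : numFieldType) (a q : K) : K :=
  limn (fun n => qpoch a q n).

Section limit_q_bernstein.
Context {R : realType}.
Implicit Types (q x : R) (f g : R -> R).

Definition qbasis (k : nat) q x : R :=
  x ^+ k * qpoch_inf x q / qpoch q q k.

(* An element of C[0,1] is represented by any f : R -> R that is continuous on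
   [0,1] (one-sidedly at 0 and 1); its values outside [0,1] play no role, as
   limit_qbernstein and supnorm01 only evaluate f on [0,1]. *)
Definition C01 : set (R -> R) := [set f : R -> R | {within `[0, 1], continuous f}].

Definition limit_qbernstein q f x : R :=
  if x == 1 then f 1
  else limn (series (fun k => f (1 - q ^+ k) * qbasis k q x)).

Definition supnorm01 g : \bar R := ereal_sup [set `|g x|%:E | x in `[0, 1]%classic].

(* The norm takes values in \bar R, so that it is +oo on unbounded operators
   and finiteness is never assumed. *)
Definition opnorm01 (T : (R -> R) -> R -> R) : \bar R :=
  ereal_sup [set supnorm01 (T f) | f in C01 `&` [set f | supnorm01 f <= 1]%E].

End limit_q_bernstein.

(* Main.v *)
(* Write p_k(q;x) for the basis functions and F(y) = sum_k y^k / (q;q)_k.  From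
   F(qy) = (1 - y) F(y) and F(q^m y) --> 1 one gets Euler's identity
   F(y) (y;q)_oo = 1, so the p_k(q;x) are the weights of a probability measure on
   the nodes 1 - q^k and ||B_q - B_r|| is the supremum over x of the total
   variation distance of two such measures; in particular it is at most 2.

   Lower bound: let q < r and let f be 1 at the nodes of q and -1 at the other
   nodes of r.  Since q < r, two consecutive nodes of r cannot both be nodes of q,
   and p_{k+1}(r;x) >= x p_k(r;x), so the nodes common to q and r have r-mass at
   most 1/(1+x); hence (B_q f - B_r f)(x) >= 2x/(1+x), which tends to 1 as x --> 1.
   As the nodes accumulate at 1, f is made continuous by prescribing its values at
   finitely many nodes only.

   Value 2: for q = 1/2, r = 1/3 the only common node is 0, of mass
   p_0(r;x) <= 1 - x.

   Value 1: for q = r^2 and r <= 1/2 one has p_{2k}(r;x) <= p_k(r^2;x), so the total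
   variation is 2 (1 - sum_k p_{2k}(r;x)) = 1 - sum_k (-1)^k p_k(r;x), and the last
   sum is F(-x) / F(x) > 0. *)
Require Import Defs.
From mathcomp Require Import all_boot all_order all_algebra ring lra.
From mathcomp Require Import all_classical all_reals all_analysis.
Import Order.TTheory GRing.Theory Num.Theory numFieldNormedType.Exports.
Local Open Scope classical_set_scope.
Local Open Scope ring_scope.

(** * Finite q-Pochhammer products: positivity and a uniform lower bound *)

Lemma qpochS (K : numFieldType) (a q : K) k :
  qpoch a q k.+1 = qpoch a q k * (1 - a * q ^+ k).
Proof. by rewrite /qpoch big_ord_recr. Qed.

Lemma qpoch0 (K : numFieldType) (a q : K) : qpoch a q 0 = 1.
Proof. by rewrite /qpoch big_ord0. Qed.

Lemma qpoch_gt0 (R : realFieldType) (a q : R) k :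
  0 < q < 1 -> `|a| < 1 -> 0 < qpoch a q k.
Proof.
move=> /andP[q0 q1] a1; apply: prodr_gt0 => s _; rewrite subr_gt0.
apply: (le_lt_trans _ a1); apply: le_trans (ler_norm _) _.
rewrite normrM [`|q ^+ s|]ger0_norm ?exprn_ge0 ?(ltW q0)//.
by rewrite ler_piMr// exprn_ile1// ltW.
Qed.

(** Keeps [(q;q)_k] away from 0 uniformly in [k], so that a geometric series dominates Euler's
    series. Each factor is bounded below by an exponential, and the exponents form a geometric
    sum. *)
Lemma qpoch_ge (R : realType) (q : R) : 0 < q < 1 ->
  exists2 c, 0 < c & forall k, c <= qpoch q q k.
Proof.
move=> hq; have /andP[q0 q1] := hq.
have q'0 : 0 < 1 - q by rewrite subr_gt0.
pose C := q / (1 - q).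
have C0 : 0 <= C by rewrite divr_ge0// ltW.
(* 1 - t >= exp (- t / (1 - q)) for 0 < t <= q *)
exists (expR (- (C / (1 - q)))); first exact: expR_gt0.
suff H k : expR (- (C * ((1 - q ^+ k) / (1 - q)))) <= qpoch q q k.
  move=> k; apply: le_trans (H k); rewrite ler_expR lerN2 ler_wpM2l//.
  by rewrite ler_pdivrMr// mulVf ?gt_eqF// gerBl exprn_ge0// ltW.
elim: k => [|k ih].
  by rewrite expr0 subrr mul0r mulr0 oppr0 expR0 qpoch0.
rewrite qpochS.
have -> : - (C * ((1 - q ^+ k.+1) / (1 - q))) =
    - (C * ((1 - q ^+ k) / (1 - q))) + - (C * q ^+ k).
  by rewrite exprS; field; rewrite gt_eqF.
rewrite expRD ler_pM ?expR_ge0//.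
set t := q * q ^+ k.
have t0 : 0 < t by rewrite mulr_gt0 ?exprn_gt0.
have tq : t <= q by rewrite /t ler_piMr ?exprn_ile1// ltW.
have -> : C * q ^+ k = t / (1 - q) by rewrite /C /t; field; rewrite gt_eqF.
(* After inversion: [1 / (1 - t) <= 1 + t / (1 - q) <= expR (t / (1 - q))], the first inequality
   because [t <= q]. *)
rewrite expRN invf_ple ?posrE ?expR_gt0 ?subr_gt0 ?(le_lt_trans tq)//.
apply: le_trans (expR_ge1Dx _).
have t1 : 0 < 1 - t by rewrite subr_gt0 (le_lt_trans tq).
rewrite -[_^-1]mul1r ler_pdivrMr//.
have -> : (1 + t / (1 - q)) * (1 - t) = 1 + t * (q - t) / (1 - q).
  by field; rewrite gt_eqF.
by rewrite lerDl divr_ge0 ?(ltW q'0)// mulr_ge0 ?(ltW t0)// subr_ge0.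
Qed.

(** * Euler's series [F] and the identity [F(y) (y;q)_oo = 1] *)

Section qexp.
Context {R : realType}.
Variable q : R.
Hypothesis hq : 0 < q < 1.

Let q0 : 0 < q. Proof. by case/andP: hq. Qed.
Let q1 : q < 1. Proof. by case/andP: hq. Qed.
Let nq1 : `|q| < 1. Proof. by rewrite gtr0_norm. Qed.

Definition qexp_coeff (y : R) k := y ^+ k / qpoch q q k.

(** The series [F(y)] of the overview, known as the q-exponential [e_q(y)]; used for [|y| < 1]. *)
Definition qexp (y : R) := limn (series (qexp_coeff y)).

Let qq0 k : 0 < qpoch q q k. Proof. exact: qpoch_gt0. Qed.

Lemma normr_qexp_coeff y k : `|qexp_coeff y k| = qexp_coeff `|y| k.
Proof. by rewrite normrM normrX [X in _ * X]gtr0_norm// invr_gt0. Qed.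

Lemma is_cvg_qexp_norm (y : R) : `|y| < 1 -> cvgn [normed series (qexp_coeff y)].
Proof.
move=> y1; have [c c0 hc] := qpoch_ge _ _ hq.
apply: (@series_le_cvg _ _ (geometric c^-1 `|y|)) => [k|k|k|].
- exact: normr_ge0.
- by rewrite /= mulr_ge0 ?invr_ge0 ?exprn_ge0// ltW.
- rewrite /= normr_qexp_coeff [leRHS]mulrC ler_wpM2l ?exprn_ge0//.
  by rewrite lef_pV2 ?posrE.
- by apply: is_cvg_geometric_series; rewrite normr_id.
Qed.

Lemma is_cvg_qexp y : `|y| < 1 -> cvgn (series (qexp_coeff y)).
Proof. by move=> /is_cvg_qexp_norm/normed_cvg. Qed.

Lemma cvg_qexp y : `|y| < 1 -> series (qexp_coeff y) @ \oo --> qexp y.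
Proof. exact: is_cvg_qexp. Qed.

Lemma normrMq_lt1 y : `|y| < 1 -> `|q * y| < 1.
Proof. by move=> y1; rewrite normrM mulr_ilt1. Qed.

Lemma normrMqX_lt1 y m : `|y| < 1 -> `|q ^+ m * y| < 1.
Proof.
by move=> y1; elim: m => [|m /normrMq_lt1]; rewrite ?mul1r// mulrA -exprS.
Qed.

(** Truncated form of [F(y) - F(qy) = y F(y)]: the constant terms cancel, and [1 - q^(k+1)] cancels
    the last factor of [(q;q)_(k+1)], which shifts the index by one. *)
Lemma series_qexp_coeffMq y n :
  series (qexp_coeff y) n.+1 - series (qexp_coeff (q * y)) n.+1 =
  y * series (qexp_coeff y) n.
Proof.
rewrite !seriesEnat/= -sumrB big_nat_recl// /qexp_coeff !expr0 subrr add0r.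
rewrite mulr_sumr; apply: eq_bigr => k _.
have -> : y ^+ k.+1 / qpoch q q k.+1 - (q * y) ^+ k.+1 / qpoch q q k.+1 =
  y ^+ k.+1 * (1 - q ^+ k.+1) / qpoch q q k.+1 by rewrite exprMn; ring.
have h : 1 - q ^+ k.+1 != 0 by rewrite subr_eq0 gt_eqF// exprn_ilt1// ltW.
rewrite qpochS -exprS exprS; field.
by rewrite h gt_eqF.
Qed.

Lemma qexpMq (y : R) : `|y| < 1 -> qexp (q * y) = qexp y * (1 - y).
Proof.
move=> y1; have qy1 := normrMq_lt1 _ y1.
have cy : series (qexp_coeff y) n.+1 @[n --> \oo] --> qexp y.
  by rewrite (cvg_shiftS (series (qexp_coeff y))); exact: cvg_qexp.
have cqy : series (qexp_coeff (q * y)) n.+1 @[n --> \oo] --> qexp (q * y).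
  by rewrite (cvg_shiftS (series (qexp_coeff (q * y)))); exact: cvg_qexp.
have h1 : y * series (qexp_coeff y) n @[n --> \oo] --> qexp y - qexp (q * y).
  by under eq_fun do rewrite -series_qexp_coeffMq; exact: cvgB.
have h2 : y * series (qexp_coeff y) n @[n --> \oo] --> y * qexp y.
  by apply: cvgM; [exact: cvg_cst|exact: cvg_qexp].
have e : qexp y - qexp (q * y) = y * qexp y by apply: cvg_unique h1 h2.
by rewrite mulrBr mulr1 [qexp y * y]mulrC -e subKr.
Qed.

Lemma qexpMqX y m : `|y| < 1 -> qexp (q ^+ m * y) = qexp y * qpoch y q m.
Proof.
move=> y1; elim: m => [|m ih]; first by rewrite mul1r qpoch0 mulr1.
rewrite exprS -mulrA qexpMq; last exact: normrMqX_lt1.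
by rewrite ih qpochS -mulrA [y * _]mulrC.
Qed.

(** The constant term of [F] is 1 and every later term gains a factor of size at most [q^m]. This
    gives [F(q^m y) --> 1] with an explicit rate. *)
Lemma qexpMqX_sub1_le y m : `|y| < 1 ->
  `|qexp (q ^+ m * y) - 1| <= q ^+ m * qexp `|y|.
Proof.
move=> y1; have y1' : `| `|y| | < 1 by rewrite normr_id.
have h1 : `|series (qexp_coeff (q ^+ m * y)) n.+1 - 1| @[n --> \oo]
    --> `|qexp (q ^+ m * y) - 1|.
  apply: cvg_norm; apply: cvgB; last exact: cvg_cst.
  rewrite (cvg_shiftS (series (qexp_coeff (q ^+ m * y)))).
  by apply: cvg_qexp; exact: normrMqX_lt1.
have h2 : q ^+ m * series (qexp_coeff `|y|) n.+1 @[n --> \oo]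
    --> q ^+ m * qexp `|y|.
  apply: cvgM; first exact: cvg_cst.
  by rewrite (cvg_shiftS (series (qexp_coeff `|y|))); exact: cvg_qexp.
apply: (ler_cvg_to h1 h2); apply: nearW => n.
rewrite !seriesEnat/= big_nat_recl// {1}/qexp_coeff expr0 qpoch0 divr1.
rewrite addrC addKr mulr_sumr big_nat_recl//.
apply: le_trans (ler_norm_sum _ _ _) _.
apply: ler_wpDl.
  by rewrite mulr_ge0 ?exprn_ge0 ?(ltW q0)// -normr_qexp_coeff.
apply: ler_sum => k _.
rewrite normr_qexp_coeff normrM [`|q ^+ m|]ger0_norm ?exprn_ge0 ?(ltW q0)//.
rewrite /qexp_coeff exprMn -mulrA; apply: ler_wpM2r.
  by rewrite -normrX -[X in _ * X]gtr0_norm ?invr_gt0// -normrM normr_ge0.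
by rewrite exprS ler_piMr ?exprn_ge0 ?exprn_ile1 ?exprn_ge0 ?(ltW q0) ?(ltW q1).
Qed.

Lemma cvg_qexpM_qpoch y : `|y| < 1 -> qexp y * qpoch y q m @[m --> \oo] --> (1 : R).
Proof.
move=> y1; under eq_fun do rewrite -qexpMqX//.
have h : q ^+ m * qexp `|y| @[m --> \oo] --> (0 : R).
  by rewrite -[0](mul0r (qexp `|y|)); apply: cvgM; [exact: cvg_expr|exact: cvg_cst].
apply: (@squeeze_cvgr _ _ _ _ (fun m => 1 - q ^+ m * qexp `|y|)
    (fun m => 1 + q ^+ m * qexp `|y|)).
- by apply: nearW => m; rewrite -ler_distlC distrC qexpMqX_sub1_le.
- by rewrite -[X in _ --> X]subr0; apply: cvgB => //; exact: cvg_cst.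
- by rewrite -[X in _ --> X]addr0; apply: cvgD => //; exact: cvg_cst.
Qed.

(** For negative [y] the terms alternate in sign, so positivity is read off the products: if
    [F(y) <= 0], then [F(y) (y;q)_m <= 0] could not tend to 1. *)
Lemma qexp_gt0 y : `|y| < 1 -> 0 < qexp y.
Proof.
move=> y1; rewrite ltNge; apply/negP => F0.
have h := cvg_qexpM_qpoch _ y1.
suff : (1 : R) <= 0 by rewrite ler10.
rewrite -(cvg_lim _ h)//; apply: limr_le; first by apply/cvg_ex; exists 1.
by apply: nearW => m; rewrite mulr_le0_ge0// ltW// qpoch_gt0.
Qed.

Lemma cvg_qpoch y : `|y| < 1 -> qpoch y q m @[m --> \oo] --> (qexp y)^-1.
Proof.
move=> y1; have F0 := qexp_gt0 _ y1.
have : (qexp y)^-1 * (qexp y * qpoch y q m) @[m --> \oo] --> (qexp y)^-1 * 1.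
  by apply: cvgM; [exact: cvg_cst|exact: cvg_qexpM_qpoch].
by rewrite mulr1; under eq_fun do rewrite mulKf ?gt_eqF//.
Qed.

Lemma qpoch_infE y : `|y| < 1 -> qpoch_inf y q = (qexp y)^-1.
Proof. by move=> y1; apply: cvg_lim => //; exact: cvg_qpoch. Qed.

Lemma qbasisE k x : `|x| < 1 -> qbasis k q x = (qexp x)^-1 * qexp_coeff x k.
Proof. by move=> x1; rewrite /qbasis qpoch_infE// mulrAC mulrC. Qed.

End qexp.

(** * The weights [p_k(q;x)] at a fixed [x] in [[0, 1)] *)

Section qbasis.
Context {R : realType}.
Variables q x : R.
Hypotheses (hq : 0 < q < 1) (hx : 0 <= x < 1).

Let q0 : 0 < q. Proof. by case/andP: hq. Qed.
Let q1 : q < 1. Proof. by case/andP: hq. Qed.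
Let x0 : 0 <= x. Proof. by case/andP: hx. Qed.
Let x1 : `|x| < 1. Proof. by rewrite ger0_norm//; case/andP: hx. Qed.
Let qq0 k : 0 < qpoch q q k.
Proof. by apply: qpoch_gt0 => //; rewrite gtr0_norm. Qed.

Lemma qbasis_ge0 k : 0 <= qbasis k q x.
Proof.
rewrite qbasisE// mulr_ge0 ?invr_ge0 ?(ltW (qexp_gt0 _ hq _ x1))//.
by rewrite divr_ge0 ?exprn_ge0// ltW.
Qed.

Lemma cvg_series_qbasis : series (fun k => qbasis k q x) @ \oo --> (1 : R).
Proof.
have F0 := qexp_gt0 _ hq _ x1.
have -> : series (fun k => qbasis k q x) =
    fun n => (qexp q x)^-1 * series (qexp_coeff q x) n.
  apply/funext => n; rewrite !seriesEnat/= mulr_sumr.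
  by apply: eq_bigr => k _; rewrite qbasisE.
rewrite -[X in _ --> X](mulVf (lt0r_neq0 F0)).
by apply: cvgM; [exact: cvg_cst|exact: cvg_qexp].
Qed.

(** Here [p_0 = 1 / F(x)], and [F(x) (1 - x) = F(qx) >= 1] because the constant term is 1 and the
    others are nonnegative. *)
Lemma qbasis0_le : qbasis 0 q x <= 1 - x.
Proof.
have F0 := qexp_gt0 _ hq _ (normrMq_lt1 _ hq _ x1).
have xlt1 : 0 < 1 - x by rewrite subr_gt0; case/andP: hx.
rewrite qbasisE// /qexp_coeff expr0 qpoch0 divr1 mulr1.
have F1 : 1 <= qexp q (q * x).
  have h : series (qexp_coeff q (q * x)) n.+1 @[n --> \oo] --> qexp q (q * x).
    rewrite (cvg_shiftS (series (qexp_coeff q (q * x)))).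
    by apply: cvg_qexp => //; exact: normrMq_lt1.
  rewrite -(cvg_lim _ h)//; apply: limr_ge; first by apply/cvg_ex; eexists; exact: h.
  apply: nearW => n; rewrite seriesEnat/= big_nat_recl// /qexp_coeff.
  rewrite expr0 qpoch0 divr1 lerDl sumr_ge0// => k _.
  by rewrite divr_ge0 ?exprn_ge0 ?mulr_ge0 ?(ltW q0)// ltW.
move: F1; rewrite qexpMq// => F1.
rewrite invf_ple ?posrE//; last exact: qexp_gt0.
by rewrite -[_^-1]mul1r ler_pdivrMr.
Qed.

(** Passing from [k] to [k + 1] multiplies the weight by [x / (1 - q^(k+1))]. *)
Lemma qbasisS_ge k : x * qbasis k q x <= qbasis k.+1 q x.
Proof.
rewrite !qbasisE// mulrCA ler_wpM2l ?invr_ge0 ?(ltW (qexp_gt0 _ hq _ x1))//.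
rewrite /qexp_coeff exprS mulrA ler_wpM2l ?mulr_ge0 ?exprn_ge0//.
rewrite lef_pV2 ?posrE// qpochS ler_piMr ?(ltW (qq0 _))//.
by rewrite gerBl mulr_ge0 ?exprn_ge0// ltW.
Qed.

Lemma cvg_limit_qbernstein (f : R -> R) :
  (forall t, 0 <= t <= 1 -> `|f t| <= 1) ->
  series (fun k => f (1 - q ^+ k) * qbasis k q x) @ \oo
    --> limit_qbernstein q f x.
Proof.
move=> hf; rewrite /limit_qbernstein lt_eqF; last by case/andP: hx.
apply: normed_cvg; apply: (@series_le_cvg _ _ (fun k => qbasis k q x)) => [k|k|k|].
- exact: normr_ge0.
- exact: qbasis_ge0.
- rewrite /= normrM [X in _ * X]ger0_norm ?qbasis_ge0//.
  rewrite ler_piMl ?qbasis_ge0// hf// gerBl subr_ge0.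
  by rewrite exprn_ile1 ?exprn_ge0 ?(ltW q0) ?(ltW q1).
- by apply/cvg_ex; exists 1; exact: cvg_series_qbasis.
Qed.

End qbasis.

(** * Pointwise bounds and the operator norm *)

Lemma normr_limit_qbernstein_le1 (R : realType) (q x : R) (f : R -> R) :
  0 < q < 1 -> 0 <= x <= 1 -> (forall t, 0 <= t <= 1 -> `|f t| <= 1) ->
  `|limit_qbernstein q f x| <= 1.
Proof.
move=> hq /andP[x0]; rewrite le_eqVlt => /predU1P[->|x1] hf.
  by rewrite /limit_qbernstein eqxx hf// ler01 lexx.
have hx : 0 <= x < 1 by rewrite x0.
have h := cvg_norm (cvg_limit_qbernstein _ _ hq hx _ hf).
have h1 := cvg_series_qbasis _ _ hq hx.
apply: (ler_cvg_to (h _) h1); apply: nearW => n.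
rewrite !seriesEnat/=; apply: le_trans (ler_norm_sum _ _ _) _.
apply: ler_sum => k _.
have p0 := qbasis_ge0 _ _ hq hx k.
rewrite normrM [X in _ * X]ger0_norm// ler_piMl// hf//.
have /andP[q0 q1] := hq.
by rewrite gerBl subr_ge0 exprn_ile1 ?exprn_ge0 ?(ltW q0) ?(ltW q1).
Qed.

Lemma supnorm01_leP (R : realType) (f : R -> R) (M : R) :
  (supnorm01 f <= M%:E)%E <-> (forall t, 0 <= t <= 1 -> `|f t| <= M).
Proof.
split=> [h t ht|h].
  rewrite -lee_fin; apply: (le_trans _ h); apply: ereal_sup_ubound.
  by exists t; rewrite //= in_itv.
apply: ge_ereal_sup => y [t /=]; rewrite in_itv/= => ht <-.
by rewrite lee_fin h.
Qed.

Lemma opnorm01_le (R : realType) (T : (R -> R) -> R -> R) (M : R) :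
  (forall f, (forall t, 0 <= t <= 1 -> `|f t| <= 1) ->
    forall x, 0 <= x <= 1 -> `|T f x| <= M) ->
  (opnorm01 T <= M%:E)%E.
Proof.
move=> h; apply: ge_ereal_sup => y [f /= [_ /supnorm01_leP hf] <-].
by apply/supnorm01_leP; exact: h.
Qed.

Lemma opnorm01_ge (R : realType) (T : (R -> R) -> R -> R) (f : R -> R) (x : R) :
  continuous f -> (forall t, 0 <= t <= 1 -> `|f t| <= 1) -> 0 <= x <= 1 ->
  ((T f x)%:E <= opnorm01 T)%E.
Proof.
move=> cf hf hx; apply: (@le_trans _ _ (supnorm01 (T f))).
  apply: (@le_trans _ _ `|T f x|%:E); first by rewrite lee_fin ler_norm.
  by apply: ereal_sup_ubound; exists x; rewrite //= in_itv.
apply: ereal_sup_ubound; exists f => //; split; last exact/supnorm01_leP.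
exact: continuous_subspaceT.
Qed.

Lemma opnorm01_subC (R : realType) (S T : (R -> R) -> R -> R) :
  opnorm01 (S \- T) = opnorm01 (T \- S).
Proof.
have E f : supnorm01 ((S \- T) f) = supnorm01 ((T \- S) f).
  by congr ereal_sup; apply: eq_imagel => x _ /=; rewrite distrC.
by congr ereal_sup; apply: eq_imagel => f _; exact: E.
Qed.

(** * Test functions and lower bounds for the norm *)

Lemma EFin_cvg_to_le (R : realType) (u : R^nat) (l : R) (y : \bar R) :
  u @ \oo --> l -> (forall n, ((u n)%:E <= y)%E) -> (l%:E <= y)%E.
Proof.
move=> ul; case: y => [y|_|/(_ 0)]; last 2 first.
- exact: leey.
- by [].
move=> h; rewrite lee_fin -(cvg_lim _ ul)//; apply: limr_le.
  by apply/cvg_ex; exists l.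
by apply: nearW => n; rewrite -lee_fin.
Qed.

(** The polynomial [p] vanishes exactly on [A], and [C] is so large that [C |p| >= 1] on [B]; hence
    [1 - 2 min(1, C |p|)] has the required values. *)
Lemma exists_continuous_separating (R : realType) (A B : seq R) :
  {in A & B, forall a b, a != b} ->
  exists f : R -> R, [/\ continuous f, forall t, `|f t| <= 1,
    {in A, forall a, f a = 1} & {in B, forall b, f b = -1}].
Proof.
move=> AB; pose p := \prod_(a <- A) ('X - a%:P).
pose C := \sum_(b <- B) `|p.[b]|^-1.
have C0 : 0 <= C by apply: sumr_ge0 => b _; rewrite invr_ge0.
have pA a : a \in A -> p.[a] = 0.
  by move=> aA; apply/eqP; rewrite -/(root p a) root_prod_XsubC.
exists (fun t => 1 - 2 * Num.min 1 (C * `|p.[t]|)); split.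
- move=> t; apply: cvgB; first exact: cvg_cst.
  apply: cvgM; first exact: cvg_cst.
  apply: (@continuous_min _ _ (fun=> 1) (fun t => C * `|p.[t]|)).
    exact: cvg_cst.
  apply: cvgM; first exact: cvg_cst.
  by apply: cvg_norm; exact: continuous_horner.
- move=> t; set m := Num.min _ _.
  have m0 : 0 <= m by rewrite le_min ler01 mulr_ge0.
  have m1 : m <= 1 by rewrite ge_min lexx.
  by rewrite ler_norml; apply/andP; split; lra.
- by move=> a aA; rewrite pA// normr0 mulr0 min_r// mulr0 subr0.
- move=> b bB; have pb0 : 0 < `|p.[b]|.
    rewrite normr_gt0 -/(root p b) root_prod_XsubC.
    by apply/negP => bA; have := AB _ _ bA bB; rewrite eqxx.
  rewrite min_l; first lra.
  by rewrite -ler_pdivrMr// mul1r /C (big_rem b)//= lerDl sumr_ge0// => c _.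
Qed.

(** The test function is 1 at the first [N] nodes of [q] and -1 at those among the first [N] nodes
    of [r] that [P] selects. At all other nodes only [-1 <= f <= 1] is used. *)
Lemma opnorm01_ge_mass (R : realType) (q r x : R) (P : pred nat) (N : nat) :
  0 < q < 1 -> 0 < r < 1 -> 0 <= x < 1 ->
  (forall k i, P k -> q ^+ i != r ^+ k) ->
  ((2 * \sum_(0 <= k < N) qbasis k q x - 2 +
    2 * \sum_(0 <= k < N | P k) qbasis k r x)%:E <=
   opnorm01 (limit_qbernstein q \- limit_qbernstein r)%R)%E.
Proof.
move=> hq hr hx hP.
have [f [cf f1 fA fB]] := exists_continuous_separating R
  [seq 1 - q ^+ k | k <- index_iota 0 N]
  [seq 1 - r ^+ k | k <- index_iota 0 N & P k] ltac:(
    by move=> _ _ /mapP[i _ ->] /mapP[k /[!mem_filter] /andP[Pk _] ->];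
       rewrite (inj_eq (addrI _)) eqr_opp; exact: hP).
have hx' : 0 <= x <= 1 by case/andP: hx => -> /ltW.
apply: (le_trans _ (opnorm01_ge _ _ _ _ cf (fun t _ => f1 t) hx')); rewrite lee_fin /=.
have fb t : -1 <= f t <= 1 by rewrite -ler_norml.
have hq1 : 2 * (\sum_(0 <= k < N) qbasis k q x) <= limit_qbernstein q f x + 1.
  (* The shift by 1 makes every term nonnegative, so the partial sum up to [N], where the factor is
     2, bounds the limit from below. *)
  pose u k := (f (1 - q ^+ k) + 1) * qbasis k q x.
  have hu : series u @ \oo --> limit_qbernstein q f x + 1.
    have -> : series u = fun n => series (fun k => f (1 - q ^+ k) * qbasis k q x) n
        + series (fun k => qbasis k q x) n.
      apply/funext => n; rewrite !seriesEnat/= -big_split/=.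
      by apply: eq_bigr => k _; rewrite /u mulrDl mul1r.
    by apply: cvgD; [exact: cvg_limit_qbernstein|exact: cvg_series_qbasis].
  have u0 k : 0 <= u k.
    by rewrite mulr_ge0 ?qbasis_ge0// -lerBlDr sub0r; case/andP: (fb (1 - q ^+ k)).
  apply: (@le_trans _ _ (series u N)).
    rewrite seriesEnat/= mulr_sumr le_eqVlt; apply/orP; left; apply/eqP.
    apply: eq_big_nat => k kN; rewrite /u fA//.
    by apply/mapP; exists k; rewrite ?mem_index_iota.
  rewrite -(cvg_lim _ hu)//; apply: nondecreasing_cvgn_le.
    by apply/nondecreasing_series => k _ _.
  by apply/cvg_ex; eexists; exact: hu.
have hr1 : 2 * (\sum_(0 <= k < N | P k) qbasis k r x) <= 1 - limit_qbernstein r f x.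
  pose u k := (1 - f (1 - r ^+ k)) * qbasis k r x.
  have hu : series u @ \oo --> 1 - limit_qbernstein r f x.
    have -> : series u = fun n => series (fun k => qbasis k r x) n -
        series (fun k => f (1 - r ^+ k) * qbasis k r x) n.
      apply/funext => n; rewrite !seriesEnat/= -sumrB.
      by apply: eq_bigr => k _; rewrite /u mulrBl mul1r.
    by apply: cvgB; [exact: cvg_series_qbasis|exact: cvg_limit_qbernstein].
  have u0 k : 0 <= u k.
    by rewrite mulr_ge0 ?qbasis_ge0// subr_ge0; case/andP: (fb (1 - r ^+ k)).
  apply: (@le_trans _ _ (series u N)).
    rewrite seriesEnat/= mulr_sumr big_mkcond/=; apply: ler_sum_nat => k kN.
    case: ifP => // Pk; rewrite /u fB; first by rewrite opprK.
    by apply/mapP; exists k; rewrite // mem_filter Pk mem_index_iota.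
  rewrite -(cvg_lim _ hu)//; apply: nondecreasing_cvgn_le.
    by apply/nondecreasing_series => k _ _.
  by apply/cvg_ex; eexists; exact: hu.
rewrite -[leRHS]/(limit_qbernstein q f x - limit_qbernstein r f x); lra.
Qed.

(** Lets [x] tend to 1 along [x = 1 - 2^-n]. *)
Lemma lee_of_onem (R : realType) (c : R) (y : \bar R) :
  (forall x, 0 <= x < 1 -> ((c * x)%:E <= y)%E) -> (c%:E <= y)%E.
Proof.
move=> h; have hh : `|2^-1 : R| < 1 by rewrite gtr0_norm ?invf_lt1// ltr1n.
have cv : c * (1 - 2^-1 ^+ n) @[n --> \oo] --> c * (1 - 0).
  apply: cvgM; first exact: cvg_cst.
  by apply: cvgB; [exact: cvg_cst|exact: cvg_expr].
rewrite -[c]mulr1 -[1]subr0; apply: (EFin_cvg_to_le R _ _ _ cv) => n.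
by apply: h; rewrite subr_ge0 exprn_ile1 ?invr_ge0 ?invf_le1 ?ler1n//= gtrBl exprn_gt0.
Qed.

Lemma opnorm01_ge1 (R : realType) (q r : R) :
  0 < q < 1 -> 0 < r < 1 -> q < r ->
  (1 <= opnorm01 (limit_qbernstein q \- limit_qbernstein r)%R)%E.
Proof.
move=> hq hr qr; apply: lee_of_onem => x hx; rewrite mul1r.
have /andP[q0 q1] := hq; have /andP[r0 r1] := hr; have /andP[x0 x1] := hx.
pose P k := ~~ `[< exists i, q ^+ i = r ^+ k >].
(* Suppose [q^i = r^k] and [q^j = r^(k+1)]. If [i < j], then [q^j <= q q^i < r r^k]; if [j <= i],
   then [r^k = q^i <= q^j = r^(k+1)]. Both are absurd. *)
have Pcons k : ~~ P k -> P k.+1.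
  move=> /negPn/asboolP[i qi]; apply/negP => /asboolP[j qj].
  have [ij|ji] := ltnP i j.
    have : q ^+ j <= q ^+ i.+1 by rewrite ler_wiXn2l ?(ltW q0) ?(ltW q1).
    rewrite qj !exprS qi leNgt => /negP; apply.
    by rewrite ltr_pM2r ?exprn_gt0.
  have : q ^+ i <= q ^+ j by rewrite ler_wiXn2l ?(ltW q0) ?(ltW q1).
  rewrite qi qj leNgt exprS => /negP; apply.
  by rewrite gtr_pMl ?exprn_gt0.
have hP k i : P k -> q ^+ i != r ^+ k.
  by move=> /asboolPn Pk; apply/eqP => qi; apply: Pk; exists i.
pose s y N := \sum_(0 <= k < N) qbasis k y x.
(* The mass of a common node [k] is charged to node [k + 1], which is not common; this is why the
   right-hand sum runs one index further. *)
have mass N : x * s r N <= (1 + x) * \sum_(0 <= k < N.+1 | P k) qbasis k r x.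
  pose n k := if P k then qbasis k r x else 0.
  have n0 k : 0 <= n k by rewrite /n; case: ifP => // _; exact: qbasis_ge0.
  have step k : x * qbasis k r x <= x * n k + n k.+1.
    rewrite /n; case: ifP => [_|/negbT/Pcons ->].
      by rewrite lerDl; exact: n0.
    by rewrite mulr0 add0r qbasisS_ge.
  rewrite big_mkcond/= -/n mulrDl mul1r addrC mulr_sumr.
  apply: (@le_trans _ _ (\sum_(0 <= k < N) (x * n k + n k.+1))).
    exact: ler_sum.
  rewrite big_split/= -mulr_sumr lerD//.
    by rewrite ler_wpM2l// big_nat_recr//= lerDl; exact: n0.
  by rewrite big_nat_recl//= lerDr; exact: n0.
have cs y : 0 < y < 1 -> s y N @[N --> \oo] --> (1 : R).
  move=> hy; have := cvg_series_qbasis _ _ hy hx.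
  by rewrite seriesEnat.
have x1' : 0 < 1 + x by lra.
(* The limiting bound [2x / (1 + x)] is at least [x] since [x <= 1]. *)
apply: (@le_trans _ _ (2 * 1 - 2 + 2 / (1 + x) * (x * 1))%:E).
  rewrite lee_fin !mulr1 subrr add0r ler_peMl// ler_pdivlMr//; lra.
apply: (EFin_cvg_to_le R (fun N => 2 * s q N.+1 - 2 + 2 / (1 + x) * (x * s r N))).
  apply: cvgD; last first.
    apply: cvgM; first exact: cvg_cst.
    by apply: cvgM; [exact: cvg_cst|exact: cs].
  apply: cvgB; last exact: cvg_cst.
  by apply: cvgM; [exact: cvg_cst|rewrite (cvg_shiftS (s q)); exact: cs].
move=> N; apply: le_trans (opnorm01_ge_mass _ _ _ _ _ N.+1 hq hr hx hP).
rewrite lee_fin lerD2l -mulrA ler_wpM2l// mulrC ler_pdivrMr// [leRHS]mulrC.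
exact: mass.
Qed.

(** Only index 0 of [r], that is the node 0, can be shared; dropping its mass, at most [1 - x],
    leaves the bound [2x]. *)
Lemma opnorm01_ge2 (R : realType) (q r : R) :
  0 < q < 1 -> 0 < r < 1 -> (forall k i, q ^+ i != r ^+ k.+1) ->
  (2%:E <= opnorm01 (limit_qbernstein q \- limit_qbernstein r)%R)%E.
Proof.
move=> hq hr qr; apply: lee_of_onem => x hx.
pose s y N := \sum_(0 <= k < N) qbasis k y x.
have cs y : 0 < y < 1 -> s y N.+1 @[N --> \oo] --> (1 : R).
  move=> hy; rewrite (cvg_shiftS (s y)); have := cvg_series_qbasis _ _ hy hx.
  by rewrite seriesEnat.
have hP k i : k != 0%N -> q ^+ i != r ^+ k by case: k.
apply: (@le_trans _ _ (2 * 1 - 2 + 2 * (1 - (1 - x)))%:E).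
  by rewrite lee_fin mulr1 subrr add0r subKr.
apply: (EFin_cvg_to_le R (fun N => 2 * s q N.+1 - 2 + 2 * (s r N.+1 - (1 - x)))).
  apply: cvgD.
    apply: cvgB; last exact: cvg_cst.
    by apply: cvgM; [exact: cvg_cst|exact: cs].
  apply: cvgM; first exact: cvg_cst.
  by apply: cvgB; [exact: cs|exact: cvg_cst].
move=> N; apply: le_trans (opnorm01_ge_mass _ _ _ _ _ N.+1 hq hr hx hP).
rewrite lee_fin lerD2l ler_wpM2l// lerBlDl /s big_nat_recl//=.
rewrite [in leRHS]big_mkcond/= big_nat_recl//= add0r lerD2r.
exact: qbasis0_le.
Qed.

Lemma opnorm01_le2 (R : realType) (q r : R) :
  0 < q < 1 -> 0 < r < 1 ->
  (opnorm01 (limit_qbernstein q \- limit_qbernstein r)%R <= 2%:E)%E.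
Proof.
move=> hq hr; apply: opnorm01_le => f hf x hx /=.
apply: le_trans (ler_normB _ _) _; rewrite -[2](natrD _ 1 1).
by rewrite lerD ?normr_limit_qbernstein_le1.
Qed.

(** * The pair [r^2], [r]: norm at most 1 *)

Lemma cvg_double : n.*2 @[n --> \oo] --> \oo.
Proof.
apply/cvgnyPge => N; near=> n.
rewrite -addnn (leq_trans _ (leq_addl n n))//; near: n; exact: nbhs_infty_ge.
Unshelve. all: by end_near. Qed.

(** Splits the factors by the parity of the exponent of [r]. *)
Lemma qpoch_double (K : numFieldType) (a r : K) n :
  qpoch a r n.*2 = qpoch a (r ^+ 2) n * qpoch (a * r) (r ^+ 2) n.
Proof.
elim: n => [|n ih]; first by rewrite !qpoch0 mulr1.
rewrite doubleS !qpochS ih (exprS r n.*2) -mul2n exprM; ring.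
Qed.

(* [x (1 - x c)] increases with [x] on [0, 1] when [c <= 1/2]; apply this to each
   [c = r^(2s+1)]. *)
Lemma qbasis_double_le (R : realType) (r x : R) k :
  0 < r <= 2^-1 -> 0 <= x < 1 -> qbasis k.*2 r x <= qbasis k (r ^+ 2) x.
Proof.
move=> /andP[r0 r2] hx; have /andP[x0 x1] := hx.
have r1 : r < 1 by lra.
have hr : 0 < r < 1 by rewrite r0.
have hr2 : 0 < r ^+ 2 < 1 by rewrite exprn_gt0// exprn_ilt1// ltW.
have nx : `|x| < 1 by rewrite ger0_norm.
have nr : `|r| < 1 by rewrite gtr0_norm.
have nr2 : `|r ^+ 2| < 1 by rewrite gtr0_norm; case/andP: hr2.
have nxr : `|x * r| < 1 by rewrite mulrC normrMq_lt1.
have a0 := qpoch_gt0 _ _ _ k hr2 nr.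
have b0 := qpoch_gt0 _ _ _ k hr2 nr2.
(* What remains of the comparison once the even factors cancel. The first [k] factors absorb [x^k];
   the other [m] lie in [[0, 1]]. *)
have main m : x ^+ k * qpoch (x * r) (r ^+ 2) (m + k) <= qpoch r (r ^+ 2) k.
  elim: m => [|m ih].
    rewrite add0n /qpoch -[X in x ^+ X]card_ord -prodr_const -big_split/=.
    apply: ler_prod => s _; set c := (r ^+ 2) ^+ s.
    have c0 : 0 <= c by rewrite !exprn_ge0// ltW.
    have c1 : c <= 1 by rewrite !exprn_ile1 ?exprn_ge0// ltW.
    have rc : r * c <= 2^-1 by apply: le_trans r2; rewrite ler_piMr// ltW.
    have rc0 : 0 <= r * c by rewrite mulr_ge0// ltW.
    have rcx : r * c * (1 + x) <= 1 by nra.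
    rewrite -mulrA; apply/andP; split.
      by rewrite mulr_ge0// subr_ge0 mulr_ile1 ?(ltW x1)//; lra.
    have -> : x * (1 - x * (r * c)) =
        1 - r * c - (1 - x) * (1 - r * c * (1 + x)) by ring.
    by rewrite gerBl mulr_ge0// subr_ge0// ltW.
  apply: le_trans ih; rewrite addSn ler_wpM2l ?exprn_ge0// qpochS.
  rewrite ler_piMr ?(ltW (qpoch_gt0 _ _ _ _ hr2 nxr))//.
  by rewrite gerBl !mulr_ge0 ?exprn_ge0// ltW.
have step m : qpoch x r (m + k).*2 * (x ^+ k.*2 / qpoch r r k.*2) <=
    qpoch x (r ^+ 2) (m + k) * (x ^+ k / qpoch (r ^+ 2) (r ^+ 2) k).
  rewrite !qpoch_double -mulrA ler_wpM2l ?(ltW (qpoch_gt0 _ _ _ _ hr2 nx))//.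
  rewrite -expr2 mulrA ler_pdivrMr ?mulr_gt0//.
  have -> : x ^+ k / qpoch (r ^+ 2) (r ^+ 2) k *
      (qpoch r (r ^+ 2) k * qpoch (r ^+ 2) (r ^+ 2) k) =
      x ^+ k * qpoch r (r ^+ 2) k by field; rewrite gt_eqF.
  rewrite -addnn exprD mulrCA ler_wpM2l ?exprn_ge0// mulrC.
  exact: main.
have dbl : (m + k).*2 @[m --> \oo] --> \oo.
  by apply: (cvg_comp _ _ (cvg_addnr k) cvg_double).
have c1 : qpoch x r (m + k).*2 * (x ^+ k.*2 / qpoch r r k.*2) @[m --> \oo] -->
    qbasis k.*2 r x.
  rewrite /qbasis mulrAC [X in _ --> X]mulrC; apply: cvgM; last exact: cvg_cst.
  rewrite qpoch_infE//.
  exact: (cvg_comp _ _ dbl (cvg_qpoch _ hr _ nx)).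
have c2 : qpoch x (r ^+ 2) (m + k) * (x ^+ k / qpoch (r ^+ 2) (r ^+ 2) k)
    @[m --> \oo] --> qbasis k (r ^+ 2) x.
  rewrite /qbasis mulrAC [X in _ --> X]mulrC; apply: cvgM; last exact: cvg_cst.
  rewrite qpoch_infE// (cvg_shiftn k (qpoch x (r ^+ 2))).
  exact: cvg_qpoch.
by apply: (ler_cvg_to c1 c2); apply: nearW.
Qed.

Lemma sum_nat_double (V : nmodType) (F : nat -> V) n :
  \sum_(0 <= k < n.*2) F k = \sum_(0 <= k < n) (F k.*2 + F k.*2.+1).
Proof.
elim: n => [|n ih]; first by rewrite !big_geq.
by rewrite doubleS !big_nat_recr//= ih addrA.
Qed.

Lemma opnorm01_sqr_le1 (R : realType) (r : R) : 0 < r <= 2^-1 ->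
  (opnorm01 (limit_qbernstein (r ^+ 2) \- limit_qbernstein r)%R <= 1%:E)%E.
Proof.
move=> hr'; have /andP[r0 r2] := hr'.
have r1 : r < 1 by lra.
have hr : 0 < r < 1 by rewrite r0.
have hq : 0 < r ^+ 2 < 1 by rewrite exprn_gt0// exprn_ilt1// ltW.
apply: opnorm01_le => f hf x /andP[x0].
change (x <= 1 ->
  `|limit_qbernstein (r ^+ 2) f x - limit_qbernstein r f x| <= 1).
rewrite le_eqVlt => /predU1P[->|x1].
  by rewrite /limit_qbernstein eqxx subrr normr0.
have hx : 0 <= x < 1 by rewrite x0.
have nx : `|x| < 1 by rewrite ger0_norm.
have nx' : `|- x| < 1 by rewrite normrN.
(* Truncation at [n] and [2n] matches the nodes, as [(r^2)^k = r^(2k)]. *)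
pose u n := series (fun k => f (1 - (r ^+ 2) ^+ k) * qbasis k (r ^+ 2) x) n -
  series (fun k => f (1 - r ^+ k) * qbasis k r x) n.*2.
pose v n := series (fun k => qbasis k (r ^+ 2) x) n -
  (qexp r x)^-1 * series (qexp_coeff r (- x)) n.*2.
have cu : `|u n| @[n --> \oo] -->
    `|limit_qbernstein (r ^+ 2) f x - limit_qbernstein r f x|.
  apply: cvg_norm; apply: cvgB; first exact: cvg_limit_qbernstein.
  exact: (cvg_comp _ _ cvg_double (cvg_limit_qbernstein _ _ hr hx _ hf)).
have cv : v n @[n --> \oo] --> 1 - (qexp r x)^-1 * qexp r (- x).
  apply: cvgB; first exact: cvg_series_qbasis.
  apply: cvgM; first exact: cvg_cst.
  exact: (cvg_comp _ _ cvg_double (cvg_qexp _ hr _ nx')).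
apply: (@le_trans _ _ (1 - (qexp r x)^-1 * qexp r (- x))).
  apply: (ler_cvg_to cu cv); apply: nearW => n /=.
  rewrite /u /v !seriesEnat/= mulr_sumr !sum_nat_double -!sumrB.
  apply: le_trans (ler_norm_sum _ _ _) _; apply: ler_sum => k _.
  have sgn m : (qexp r x)^-1 * qexp_coeff r (- x) m = (-1) ^+ m * qbasis m r x.
    by rewrite qbasisE// /qexp_coeff (exprNn x) -!mulrA mulrCA.
  rewrite !sgn (exprS (-1)) -signr_odd odd_double expr0 mulr1 mul1r mulN1r.
  have ub s (h : 0 < s < 1) m : `|f (1 - s ^+ m)| <= 1.
    have /andP[s0 s1] := h; apply: hf; rewrite gerBl subr_ge0.
    by rewrite exprn_ile1 ?exprn_ge0 ?(ltW s0) ?(ltW s1).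
  have Ep : 0 <= qbasis k (r ^+ 2) x - qbasis k.*2 r x.
    by rewrite subr_ge0 qbasis_double_le.
  have Op := qbasis_ge0 _ _ hr hx k.*2.+1.
  (* The two terms at the common node merge into one with the nonnegative coefficient of [Ep]; the
     odd node keeps its weight from [r]. *)
  rewrite -exprM mul2n opprD addrA -mulrBr opprD opprK addrA.
  apply: le_trans (ler_normB _ _) _.
  by apply: lerD; rewrite normrM [X in _ * X]ger0_norm// ler_piMl// (ub _ hr).
by rewrite gerBl mulr_ge0 ?invr_ge0 ?(ltW (qexp_gt0 _ hr _ _)).
Qed.

(** * Explicit pairs and the conclusion *)

Lemma expr2V_neq_expr3V (R : numFieldType) (k i : nat) :
  2^-1 ^+ i != 3^-1 ^+ k.+1 :> R.
Proof.
rewrite !exprVn (inj_eq invr_inj) -!natrX eqr_nat.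
(* 3 divides [3^(k+1)] but no power of 2. *)
by apply/eqP => /(congr1 (dvdn 3)); rewrite [RHS]dvdn_exp// Euclid_dvdX.
Qed.

Theorem corollary1p7 (R : realType) :
  (forall q r : R, 0 < q < 1 -> 0 < r < 1 -> q != r ->
     (1 <= opnorm01 (limit_qbernstein q \- limit_qbernstein r)%R <= 2)%E) /\
  (exists q r : R, [/\ 0 < q < 1, 0 < r < 1, q != r &
     opnorm01 (limit_qbernstein q \- limit_qbernstein r)%R = 1%E]) /\
  (exists q r : R, [/\ 0 < q < 1, 0 < r < 1, q != r &
     opnorm01 (limit_qbernstein q \- limit_qbernstein r)%R = 2%E]).
Proof.
split; last split.
- move=> q r hq hr; rewrite neq_lt opnorm01_le2// andbT => /orP[qr|rq].
    exact: opnorm01_ge1.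
  by rewrite opnorm01_subC opnorm01_ge1.
- have h : 0 < (2^-1 : R) < 1 by lra.
  have h2 : 0 < (2^-1 : R) ^+ 2 < 1 by rewrite expr2; lra.
  have h3 : (2^-1 : R) ^+ 2 < 2^-1 by rewrite expr2; lra.
  exists (2^-1 ^+ 2), 2^-1; split=> //; first by rewrite lt_eqF.
  apply/eqP; rewrite eq_le opnorm01_ge1// andbT.
  by apply: opnorm01_sqr_le1; lra.
- have h2 : 0 < (2^-1 : R) < 1 by lra.
  have h3 : 0 < (3^-1 : R) < 1 by lra.
  exists 2^-1, 3^-1; split=> //; first exact: (expr2V_neq_expr3V R 0 1).
  apply/eqP; rewrite eq_le opnorm01_le2//=; apply: opnorm01_ge2 => // k i.
  exact: expr2V_neq_expr3V.
Qed.
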